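(* Let $(A_j)_{j\in J}$ be an arbitrary family of abelian pro-Lie groups. Let $P:=\prod_{j\in J}A_j$ be the cartesian product with the product (Tychonoff) topology, and for each $j\in J$ let $\tau_j\colon A_j\to P$ be the canonical embedding, given by $\tau_j(a)=(a_k)_{k\in J}$ with $a_j=a$ and $a_k=0$ for $k\neq j$. Then $P$, with the canonical embeddings $\tau_j$ ($j\in J$) as coprojections, is the conditional coproduct of the family $(A_j)_{j\in J}$ in the category of abelian pro-Lie groups.
   Context: A pro-Lie group is a topological group that is a projective limit of (finite-dimensional real) Lie groups; such a group $G$ has a filter basis $\mathcal N(G)$ of closed normal subgroups $N$ such that $G/N$ is a Lie group, and $G\cong\varprojlim_{N\in\mathcal N(G)}G/N$ algebraically and topologically. The category of abelian pro-Lie groups has the abelian pro-Lie groups as objects and continuous group homomorphisms as morphisms. Cartesian products of pro-Lie groups are pro-Lie groups. Convergent family: let $(A_j)_{j\in J}$ be a family of topological groups, $H$ a topological group, and $(\phi_j)_{j\in J}$ a family of continuous homomorphisms $\phi_j\colon A_j\to H$. The family is convergent if for every identity neighborhood $U$ of $H$ the set $\{j\in J:\phi_j(A_j)\not\subseteq U\}$ is finite. Conditional coproduct: in a category $\mathcal A$ of topological groups, an object $G$ is a conditional coproduct of a family $(A_j)_{j\in J}$ of objects if there is a convergent family of morphisms $\tau_j\colon A_j\to G$, $j\in J$ (called the coprojections), such that for every object $H$ of $\mathcal A$ and every convergent family of morphisms $\psi_j\colon A_j\to H$, $j\in J$, in $\mathcal A$ there is a unique morphism $\omega\colon G\to H$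 with $\psi_j=\omega\circ\tau_j$ for all $j\in J$. *)

(* Defs.v *)
From HB Require Import structures.
From mathcomp Require Import all_boot all_algebra.
From mathcomp Require Import boolp classical_sets functions cardinality reals.
From mathcomp Require Import topology normedtype derive.

Set Implicit Arguments.
Unset Strict Implicit.
Unset Printing Implicit Defensive.

Import GRing.Theory Num.Theory.
Import numFieldNormedType.Exports.

Local Open Scope classical_set_scope.
Local Open Scope group_scope.

(* Topological groups are not assumed Hausdorff, and are written
   multiplicatively even when they are commutative. *)
HB.mixin Record isTopologicalGroup G & Topological G & Group G := {
  mulg_continuous : continuous (fun z : G * G => z.1 * z.2) ;
  invg_continuous : continuous (fun x : G => x^-1)
}.

#[short(type="topGroupType")]
HB.structure Definition TopologicalGroup :=
  {G of Topological G & Group G & isTopologicalGroup G}.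

Definition top_hom (G H : topGroupType) (f : G -> H) : Prop :=
  {morph f : x y / x * y} /\ continuous f.

Definition top_iso (G H : topGroupType) : Prop :=
  exists (f : G -> H) (g : H -> G),
    [/\ top_hom f, top_hom g, cancel f g & cancel g f].

Section Product.
Context {I : Type} (A : I -> topGroupType).
Local Notation P := (prod_topology A).

Let pone : P := fun=> 1.
Let pinv (x : P) : P := fun i => (x i)^-1.
Let pmul (x y : P) : P := fun i => x i * y i.

Let pmulA : associative pmul.
Proof. by move=> x y z; apply: functional_extensionality_dep => i; exact: mulgA. Qed.
Let pmul1 : left_id pone pmul.
Proof. by move=> x; apply: functional_extensionality_dep => i; exact: mul1g. Qed.
Let pmulr1 : right_id pone pmul.
Proof. by move=> x; apply: functional_extensionality_dep => i; exact: mulg1. Qed.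
Let pmulV : left_inverse pone pinv pmul.
Proof. by move=> x; apply: functional_extensionality_dep => i; exact: mulVg. Qed.
Let pmulrV : right_inverse pone pinv pmul.
Proof. by move=> x; apply: functional_extensionality_dep => i; exact: mulgV. Qed.

HB.instance Definition _ :=
  isGroup.Build P pmulA pmul1 pmulr1 pmulV pmulrV.

Lemma proj_cts (i : I) : continuous (fun x : P => x i).
Proof. exact: (@proj_continuous {classic I} A i). Qed.

Lemma into_prod_cts (T : topologicalType) (f : T -> P) :
  (forall i, continuous (fun t => f t i)) -> continuous f.
Proof.
move=> cf t; apply/cvg_sup => i; apply/cvg_image.
  rewrite eqEsubset; split=> // y _; exists (@dfwith {classic I} A (f t) i y) => //.
  exact: (@dfwith_in {classic I} A).
move=> U fU; have := cf i t _ fU.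
rewrite /= => h.
exists ((fun x : P => x i) @^-1` U) => //.
rewrite eqEsubset; split=> [y [x Ux <-//]|y Uy].
by exists (@dfwith {classic I} A (f t) i y); rewrite /= (@dfwith_in {classic I} A).
Qed.

Let pmul_cts : continuous (fun z : P * P => z.1 * z.2).
Proof.
apply: into_prod_cts => i z.
apply: (@continuous_comp _ _ _ (fun z : P * P => (z.1 i, z.2 i))
  (fun w : A i * A i => w.1 * w.2)); last exact: mulg_continuous.
apply: cvg_pair.
  apply: (@continuous_comp _ _ _ fst (fun x : P => x i)); first exact: cvg_fst.
  exact: proj_cts.
apply: (@continuous_comp _ _ _ snd (fun x : P => x i)); first exact: cvg_snd.
exact: proj_cts.
Qed.

Let pinv_cts : continuous (fun x : P => x^-1).
Proof.
apply: into_prod_cts => i x.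
apply: (@continuous_comp _ _ _ (fun x : P => x i) (fun a : A i => a^-1)).
  exact: proj_cts.
exact: invg_continuous.
Qed.

HB.instance Definition _ := isTopologicalGroup.Build P pmul_cts pinv_cts.

End Product.

(* The index type of the family carries no decidable equality, hence the
   detour through {classic I}. *)
Definition prod_embed (I : Type) (A : I -> topGroupType) (i : I) (a : A i) :
  prod_topology A := @dfwith {classic I} A (fun=> 1) i a.

Record proj_system := ProjSystem {
  ps_idx : Type ;
  ps_le : ps_idx -> ps_idx -> Prop ;
  ps_obj : ps_idx -> topGroupType ;
  ps_map : forall i j, ps_le i j -> ps_obj j -> ps_obj i ;
  ps_inh : inhabited ps_idx ;
  ps_refl : forall i, ps_le i i ;
  ps_trans : forall i j k, ps_le i j -> ps_le j k -> ps_le i k ;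
  ps_directed : forall i j, exists k, ps_le i k /\ ps_le j k ;
  ps_hom : forall i j (ij : ps_le i j), top_hom (ps_map ij) ;
  ps_id : forall i (ii : ps_le i i) x, ps_map ii x = x ;
  ps_comp : forall i j k (ij : ps_le i j) (jk : ps_le j k) (ik : ps_le i k) x,
    ps_map ij (ps_map jk x) = ps_map ik x
}.

Definition threads (S : proj_system) : set (prod_topology (@ps_obj S)) :=
  [set x | forall i j (ij : ps_le i j), ps_map ij (x j) = x i].

(* The underlying space is the set of threads with the topology induced by the
   product topology. *)
Definition proj_lim (S : proj_system) : Type := set_type (@threads S).

Section ProjLim.
Context (S : proj_system).
Local Notation P := (prod_topology (@ps_obj S)).
Local Notation L := (proj_lim S).

HB.instance Definition _ := Topological.copy L (set_type (@threads S)).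
HB.instance Definition _ := SubChoice.copy L (set_type (@threads S)).

Let threads_closed : group_closed (mem (@threads S)).
Proof.
have hom1 i j (ij : ps_le i j) : ps_map ij 1 = 1.
  have [fM _] := ps_hom ij.
  by apply: (@mulgI _ (ps_map ij 1)); rewrite -fM !mulg1.
split=> [|x y]; first by rewrite inE => i j ij; exact: hom1.
rewrite !inE => xT yT i j ij; have [fM _] := ps_hom ij.
change (ps_map ij (x j * (y j)^-1) = x i * (y i)^-1).
rewrite fM xT -(yT i j ij); congr (_ * _).
by apply: (@mulgI _ (ps_map ij (y j))); rewrite -fM !mulgV hom1.
Qed.

HB.instance Definition _ := SubChoice_isSubGroup.Build P _ L threads_closed.

Let vL : L -> P := val.

Let vL_cts : continuous vL.
Proof. exact: (@initial_continuous (set_type (@threads S)) P set_val). Qed.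

Let into_L_cts (T : topologicalType) (f : T -> L) :
  continuous (vL \o f) -> continuous f.
Proof. by move=> cf; apply: continuous_comp_initial. Qed.

Let lmul_cts : continuous (fun z : L * L => z.1 * z.2).
Proof.
apply: (@into_L_cts (L * L)%type) => z.
apply: (@continuous_comp _ _ _ (fun z : L * L => (vL z.1, vL z.2))
  (fun w : P * P => w.1 * w.2)); last exact: mulg_continuous.
apply: (@cvg_pair _ _ _ _ (nbhs (vL z.1)) (nbhs (vL z.2))).
  by apply: (@continuous_comp _ _ _ fst vL); [exact: cvg_fst|exact: vL_cts].
by apply: (@continuous_comp _ _ _ snd vL); [exact: cvg_snd|exact: vL_cts].
Qed.

Let linv_cts : continuous (fun x : L => x^-1).
Proof.
apply: (@into_L_cts L) => x.
apply: (@continuous_comp _ _ _ vL (fun a : P => a^-1)); first exact: vL_cts.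
exact: invg_continuous.
Qed.

HB.instance Definition _ := isTopologicalGroup.Build L lmul_cts linv_cts.

End ProjLim.

Section Smooth.
Local Open Scope ring_scope.
Variable R : realType.

(* Meant for open U; the partial derivatives are those along the standard
   basis of R^m. *)
Fixpoint Cdiff (m n k : nat) (U : set 'rV[R]_m) (f : 'rV[R]_m -> 'rV[R]_n) :
    Prop :=
  (forall x, U x -> {for x, continuous f}) /\
  if k is k'.+1 then
    forall i : 'I_m, (forall x, U x -> derivable f x (delta_mx 0 i)) /\
                     Cdiff k' U (fun x => 'D_(delta_mx 0 i) f x)
  else True.

Definition smooth_on (m n : nat) (U : set 'rV[R]_m)
    (f : 'rV[R]_m -> 'rV[R]_n) : Prop :=
  forall k, Cdiff k U f.

(* A homeomorphism from an open subset of M onto an open subset of R^n; the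
   values of the two total functions outside these sets are irrelevant. *)
Record chart (M : topologicalType) (n : nat) := Chart {
  cdom : set M ;
  ccod : set 'rV[R]_n ;
  cmap : M -> 'rV[R]_n ;
  cinv : 'rV[R]_n -> M ;
  cdom_open : open cdom ;
  ccod_open : open ccod ;
  cmap_cod : forall x, cdom x -> ccod (cmap x) ;
  cinv_dom : forall y, ccod y -> cdom (cinv y) ;
  cmapK : forall x, cdom x -> cinv (cmap x) = x ;
  cinvK : forall y, ccod y -> cmap (cinv y) = y ;
  cmap_cts : forall x, cdom x -> {for x, continuous cmap} ;
  cinv_cts : forall y, ccod y -> {for y, continuous cinv}
}.

Definition smooth_atlas (M : topologicalType) (n : nat)
    (At : set (chart M n)) : Prop :=
  (forall x : M, exists2 c, At c & cdom c x) /\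
  (forall c d, At c -> At d ->
     smooth_on [set y | ccod c y /\ cdom d (cinv c y)]
               (fun y => cmap d (cinv c y))).

(* Points of R^n x R^n are encoded as row vectors of length n + n. *)
Definition smooth_mul (G : topGroupType) (n : nat)
    (At : set (chart G n)) : Prop :=
  forall c d e, At c -> At d -> At e ->
    let f (z : 'rV[R]_(n + n)) :=
      (cinv c (lsubmx z) * cinv d (rsubmx z))%g in
    smooth_on [set z | [/\ ccod c (lsubmx z), ccod d (rsubmx z) & cdom e (f z)]]
              (fun z => cmap e (f z)).

Definition smooth_inv (G : topGroupType) (n : nat)
    (At : set (chart G n)) : Prop :=
  forall c d, At c -> At d ->
    smooth_on [set y | ccod c y /\ cdom d (cinv c y)^-1%g]
              (fun y => cmap d (cinv c y)^-1%g).

(* No countability condition is imposed, so every discrete group is a Lie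
   group of dimension 0. *)
Definition is_Lie_group (G : topGroupType) : Prop :=
  hausdorff_space G /\
  exists (n : nat) (At : set (chart G n)),
    [/\ smooth_atlas At, smooth_mul At & smooth_inv At].

Definition is_proLie_group (G : topGroupType) : Prop :=
  exists S : proj_system,
    (forall i : ps_idx S, is_Lie_group (ps_obj i)) /\ top_iso G (proj_lim S).

Definition is_abelian_proLie_group (G : topGroupType) : Prop :=
  is_proLie_group G /\ commutative (fun x y : G => (x * y)%g).

End Smooth.

Definition convergent_family (J : Type) (A : J -> topGroupType)
    (H : topGroupType) (phi : forall j, A j -> H) : Prop :=
  forall U : set H, nbhs 1 U -> finite_set [set j | ~ range (phi j) `<=` U].

(* The category is the full subcategory of topological groups on the class C
   of objects. *)
Definition is_conditional_coproduct (C : topGroupType -> Prop) (J : Type)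
    (A : J -> topGroupType) (G : topGroupType) (tau : forall j, A j -> G) :
    Prop :=
  [/\ C G,
      (forall j, top_hom (tau j)),
      convergent_family tau &
      forall (H : topGroupType) (psi : forall j, A j -> H),
        C H -> (forall j, top_hom (psi j)) -> convergent_family psi ->
        exists! omega : G -> H,
          top_hom omega /\ (forall j, psi j = omega \o tau j)].

(* Main.v *)
Require Import Defs.
From mathcomp Require Import all_boot all_algebra.
From mathcomp Require Import boolp classical_sets functions cardinality reals.
From mathcomp Require Import topology normedtype derive.
From mathcomp Require Import order ring lra.

(** Lie groups have no small subgroups: in a chart around 1 squaring doubles
    displacements up to first order, so a nontrivial element cannot have all
    its powers near 1. Hence, if [H] is the limit of Lie groups [H_i], a
    convergent family [psi_j : A_j -> H] induces for each [i] a family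
    [A_j -> H_i] with only finitely many nontrivial members, whose finite
    product (formed in the commutative group [H]) is a morphism from the
    product of the [A_j] to [H_i]. Elements of finite support are dense in the
    product, which makes these morphisms unique; they therefore form a
    compatible family and define the required morphism into [H].

    The product is itself pro-Lie because finite products of Lie groups are Lie
    groups and a product of limits of projective systems is the limit of the
    system of finite products of their objects. *)

Set Implicit Arguments.
Unset Strict Implicit.
Unset Printing Implicit Defensive.

Import Order.TTheory GRing.Theory Num.Theory.
Import numFieldNormedType.Exports.

Local Open Scope classical_set_scope.
Local Open Scope group_scope.

(** * Homomorphisms on products and projective limits *)

(** Passing to [{classic J}] provides the equality test needed to enumerate the set. An entry of the
    list that occurs again later is skipped, which is why the step may assume [~ A a]. *)
Lemma finite_set_ind (J : Type) (Q : set J -> Prop) :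
  Q set0 ->
  (forall A a, finite_set A -> ~ A a -> Q A -> Q (a |` A)) ->
  forall A, finite_set A -> Q A.
Proof.
move=> Q0 QU A /(@finite_seqP {classic J})[s ->]; elim: s => [|a s IHs].
  by rewrite classical_sets.set_nil.
have -> : [set` a :: s] = a |` [set` s].
  by apply/seteqP; split=> x /=; rewrite in_cons; [case/predU1P|case=> [->|->]];
    rewrite ?eqxx ?orbT; auto.
have [sa|nsa] := pselect ([set` s] a).
  by rewrite (_ : a |` _ = [set` s]) //; apply/setUidPr => _ ->.
by apply: QU => //; exact: (@finite_seq {classic J}).
Qed.

Lemma top_hom1 (G H : topGroupType) (f : G -> H) : top_hom f -> f 1 = 1.
Proof. by case=> fM _; apply: (@mulgI _ (f 1)); rewrite -fM !mulg1. Qed.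

Lemma top_hom_comp (G H K : topGroupType) (f : G -> H) (g : H -> K) :
  top_hom f -> top_hom g -> top_hom (g \o f).
Proof.
move=> [fM fc] [gM gc]; split=> [x y|x]; first by rewrite /= fM gM.
exact: (@continuous_comp _ _ _ f g x (fc x) (gc _)).
Qed.

Lemma top_hom_cst1 (G H : topGroupType) : top_hom (fun _ : G => 1 : H).
Proof. by split=> [x y|x]; [rewrite mulg1|exact: cvg_cst]. Qed.

Lemma continuous_pair_at (T M N : topologicalType) (f : T -> M) (g : T -> N)
    (x : T) :
  {for x, continuous f} -> {for x, continuous g} ->
  {for x, continuous (fun x => (f x, g x))}.
Proof. by move=> fc gc; apply: cvg_pair; [exact: fc|exact: gc]. Qed.

Lemma continuous_mulg_at (T : topologicalType) (H : topGroupType)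
    (f g : T -> H) (x : T) :
  {for x, continuous f} -> {for x, continuous g} ->
  {for x, continuous (fun x => f x * g x)}.
Proof.
move=> fc gc; apply: (@continuous_comp _ _ _ (fun x => (f x, g x))
  (fun z : H * H => z.1 * z.2)); last exact: mulg_continuous.
exact: continuous_pair_at.
Qed.

Lemma continuous_mulg (T : topologicalType) (H : topGroupType) (f g : T -> H) :
  continuous f -> continuous g -> continuous (fun x => f x * g x).
Proof. by move=> fc gc x; apply: continuous_mulg_at; [exact: fc|exact: gc]. Qed.

(** * Morphisms out of a product and elements of finite support *)

Section Product.
Context {J : Type} (A : J -> topGroupType).
Local Notation P := (prod_topology A).
Implicit Types (x y : P) (F : set J).

Lemma prod_mulE x y j : (x * y) j = x j * y j. Proof. by []. Qed.

Lemma top_hom_proj j : top_hom (fun x : P => x j).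
Proof. by split=> //; exact: proj_cts. Qed.

Lemma prod_embed_in j (a : A j) : prod_embed a j = a.
Proof. exact: (@dfwith_in {classic J}). Qed.

Lemma prod_embed_out j k (a : A j) : j <> k -> prod_embed a k = 1.
Proof. by move=> jk; apply: (@dfwith_out {classic J}); apply/eqP. Qed.

Lemma top_hom_prod_embed j : top_hom (@prod_embed J A j).
Proof.
split=> [a b|].
  apply: functional_extensionality_dep => k; rewrite prod_mulE.
  have [jk|jk] := pselect (j = k); first by subst k; rewrite !prod_embed_in.
  by rewrite !prod_embed_out // mulg1.
apply: into_prod_cts => k; have [jk|jk] := pselect (j = k).
  subst k; rewrite (_ : (fun t => _) = id); first by move=> x; exact: cvg_id.
  by apply/funext => a; rewrite prod_embed_in.
rewrite (_ : (fun t => _) = fun=> 1); first by move=> x; exact: cvg_cst.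
by apply/funext => a; rewrite prod_embed_out.
Qed.

(** The filter generated by the subgroups of families trivial on a finite set, that is, the
    neighbourhood filter of 1 for the product of the discrete topologies. *)
Definition finsupp_nbhs1 : set_system P :=
  [set U | exists2 F, finite_set F & [set x | forall j, F j -> x j = 1] `<=` U].

Lemma finsupp_nbhs1_filter : Filter finsupp_nbhs1.
Proof.
split.
- by exists set0.
- move=> U V [F Ff FU] [F' Ff' FV]; exists (F `|` F');
    first by rewrite finite_setU.
  by move=> x xF; split; [apply: FU|apply: FV] => j Fj; apply: xF; [left|right].
- by move=> U V UV [F Ff FU]; exists F => //; apply: subset_trans UV.
Qed.

(** It suffices that the filter [finsupp_nbhs1] converges to 1, and this can be tested on each
    coordinate: a neighbourhood of 1 in [A i] contains the [i]-th entry of every family trivial at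
    [i]. *)
Lemma nbhs1_finite (U : set P) : nbhs (1 : P) U ->
  exists2 F, finite_set F & forall x, (forall j, F j -> x j = 1) -> U x.
Proof.
have FF := finsupp_nbhs1_filter.
suff h : finsupp_nbhs1 --> (1 : P) by move=> /h[F Ff FU]; exists F.
apply/cvg_sup => i; apply/cvg_image.
  rewrite eqEsubset; split=> // y _; exists (prod_embed y) => //.
  exact: prod_embed_in.
move=> V /nbhs_singleton V1; exists ((fun x : P => x i) @^-1` V).
  by exists [set i] => // x /(_ i erefl) xi; rewrite /= xi.
rewrite eqEsubset; split=> [y [x Ux <-//]|y Uy].
by exists (prod_embed y); rewrite /= ?prod_embed_in.
Qed.

Lemma convergent_prod_embed : convergent_family (@prod_embed J A).
Proof.
move=> U /nbhs1_finite[F Ff FU]; apply: sub_finite_set Ff => j /=.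
apply: contra_notP => nFj _ [a _ <-]; apply: FU => k Fk.
by apply: prod_embed_out => jk; apply: nFj; rewrite jk.
Qed.

Lemma hom_eq_finsupp (H : topGroupType) (f g : P -> H) F :
  finite_set F -> top_hom f -> top_hom g ->
  (forall j a, f (@prod_embed J A j a) = g (prod_embed a)) ->
  forall x, (forall j, ~ F j -> x j = 1) -> f x = g x.
Proof.
move=> + fh gh fg; elim/finite_set_ind => {F} [x x1|F k _ nFk IHF x xF].
  suff -> : x = 1 by rewrite (top_hom1 fh) (top_hom1 gh).
  by apply: functional_extensionality_dep => j; exact: (x1 j id).
(* Dividing out the entry at [k] leaves an element supported in the smaller set, to which the
   induction hypothesis applies. *)
pose y : P := x * (prod_embed (x k))^-1.
have yF j : ~ F j -> y j = 1.
  move=> nFj; rewrite /y prod_mulE.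
  change (x j * (prod_embed (x k) j)^-1 = 1).
  have [kj|kj] := pselect (k = j);
    first by subst j; rewrite prod_embed_in mulgV.
  rewrite prod_embed_out // invg1 mulg1 xF // => -[jk|//].
  by apply: kj.
rewrite -(mulgVK (prod_embed (x k)) x) -/y.
by rewrite (proj1 fh) (proj1 gh) fg IHF.
Qed.

(* The elements of finite support are dense. *)
Lemma hom_eq_prod_embed (H : topGroupType) (f g : P -> H) :
  hausdorff_space H -> top_hom f -> top_hom g ->
  (forall j a, f (@prod_embed J A j a) = g (prod_embed a)) -> f = g.
Proof.
move=> hH fh gh fg; apply/funext => x; apply: hH => U V fU gV.
have lx : (fun y : P => x * y) @ nbhs (1 : P) --> x.
  rewrite -[X in _ --> X]mulg1; apply: (@continuous_mulg _ _ (fun=> x) id).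
    exact: cst_continuous.
  by move=> ?; exact: cvg_id.
have [F Ff FUV] :=
  nbhs1_finite (filterI (lx _ (proj2 fh x U fU)) (lx _ (proj2 gh x V gV))).
(* Being trivial on [F], [y] keeps [x * y] in both preimages; off [F] it cancels [x], so [x * y] has
   finite support and [f] and [g] agree on it. *)
pose y : P := fun j => if pselect (F j) then 1 else (x j)^-1.
have [|/= Uy Vy] := FUV y;
  first by move=> j Fj; rewrite /y; case: (pselect (F j)).
exists (f (x * y)); split=> //.
rewrite (@hom_eq_finsupp H f g F) // => j nFj; rewrite prod_mulE /y.
by case: (pselect (F j)) => //= _; rewrite mulgV.
Qed.

(** The map is the product of the [psi j (x j)] over [j] in [F], built one factor at a time;
    commutativity of [H] makes it multiplicative. *)
Lemma exists_hom_finite (H : topGroupType) (psi : forall j, A j -> H) F :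
  commutative (fun x y : H => x * y) -> (forall j, top_hom (psi j)) ->
  finite_set F ->
  exists2 w : P -> H, top_hom w &
    forall j a, w (@prod_embed J A j a) = if pselect (F j) then psi j a else 1.
Proof.
move=> Hc psih; elim/finite_set_ind => {F} [|F k _ nFk [w wh wF]].
  exists (fun=> 1) => [|j a]; first exact: top_hom_cst1.
  by case: pselect.
exists (fun x => psi k (x k) * w x).
  split=> [x y|]; last first.
    apply: continuous_mulg; last by case: wh.
    exact: (proj2 (top_hom_comp (top_hom_proj k) (psih k))).
  rewrite prod_mulE (proj1 (psih k)) (proj1 wh) !mulgA; congr (_ * _).
  by rewrite -!mulgA; congr (_ * _); rewrite Hc.
move=> j a; rewrite wF; have [jk|jk] := pselect (j = k).
  subst k; rewrite prod_embed_in.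
  case: pselect => //= _; case: pselect => [/= _|[]]; last by left.
  by rewrite mulg1.
rewrite prod_embed_out // (top_hom1 (psih k)) mul1g.
case: pselect => [Fj|nFj]; case: pselect => [kFj|nkFj] //=.
  by case: nkFj; right.
by case: kFj.
Qed.

End Product.

Arguments top_hom_proj {J A} j.

Lemma top_hom_into_prod (G : topGroupType) (I : Type) (B : I -> topGroupType)
    (f : G -> prod_topology B) :
  (forall i, top_hom (fun x => f x i)) -> top_hom f.
Proof.
move=> fh; split=> [x y|]; last by apply: into_prod_cts => i; case: (fh i).
by apply: functional_extensionality_dep => i; exact: (proj1 (fh i)).
Qed.

(** * The universal property of projective limits *)

Section ProjLimit.
Context (S : proj_system).
Local Notation L := (proj_lim S).
Local Notation Q := (prod_topology (@ps_obj S)).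

Definition lim_proj (i : ps_idx S) (x : L) : ps_obj i := (val x : Q) i.

Lemma lim_proj_ext (x y : L) : (forall i, lim_proj i x = lim_proj i y) -> x = y.
Proof.
by move=> xy; apply: val_inj; apply: functional_extensionality_dep => i;
  exact: xy.
Qed.

Lemma lim_projP i j (ij : ps_le i j) (x : L) :
  ps_map ij (lim_proj j x) = lim_proj i x.
Proof. by have := valP x; rewrite inE => /(_ i j ij). Qed.

Lemma top_hom_lim_proj i : top_hom (lim_proj i).
Proof.
split=> // x; apply: (@continuous_comp _ _ _ (val : L -> Q) (fun y : Q => y i)).
  exact: (@initial_continuous (set_type (@threads S)) Q set_val).
exact: proj_cts.
Qed.

(** The existence half of the universal property of the limit; [lim_proj_ext] gives uniqueness. *)
Lemma lim_lift (G : topGroupType) (f : forall i, G -> ps_obj i) :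
  (forall i, top_hom (f i)) ->
  (forall i j (ij : ps_le i j) x, ps_map ij (f j x) = f i x) ->
  exists2 h : G -> L, top_hom h & forall i x, lim_proj i (h x) = f i x.
Proof.
move=> fh ft.
have th x : (fun i => f i x : ps_obj i) \in @threads S.
  by rewrite inE => i j ij; exact: ft.
pose h x : L := Sub (fun i => f i x : ps_obj i) (th x).
have hE i x : lim_proj i (h x) = f i x by rewrite /lim_proj /h SubK.
exists h => //; split=> [x y|].
  apply: lim_proj_ext => i.
  by rewrite (proj1 (top_hom_lim_proj i)) !hE (proj1 (fh i)).
apply: (@continuous_comp_initial _ _ _ (set_val : set_type (@threads S) -> Q)).
apply: into_prod_cts => i.
rewrite (_ : (fun _ => _) = f i); first by case: (fh i).
by apply/funext => x; exact: hE.
Qed.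

End ProjLimit.

(** * Finite products of Lie groups *)

Section Calculus.
Local Open Scope ring_scope.
Context {R : realType}.

Lemma cvg_rV (T : Type) (F : set_system T) {FF : Filter F} n
    (f : T -> 'rV[R]_n) (a : 'rV[R]_n) :
  (forall j, (fun x => f x 0 j) @ F --> a 0 j) -> f @ F --> a.
Proof.
move=> fa A [B aB BA];
apply: (filterS (P := fun x => forall j, B 0 j (f x 0 j))).
  by move=> x Bx; apply: BA => i j; rewrite (ord1 i).
by apply: filter_forall => j; apply: fa; exact: aB.
Qed.

Lemma cvg_row_mx (T : Type) (F : set_system T) {FF : Filter F} m n
    (f : T -> 'rV[R]_m) (g : T -> 'rV[R]_n) (a : 'rV[R]_m) (b : 'rV[R]_n) :
  f @ F --> a -> g @ F --> b ->
  (fun x => row_mx (f x) (g x)) @ F --> row_mx a b.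
Proof.
move=> fa gb; apply: cvg_rV => j; rewrite -[j]splitK;
  case: (fintype.split j) => k.
  rewrite /= row_mxEl; under eq_fun do rewrite row_mxEl.
  by move=> V /(@coord_continuous _ _ _ 0 k a) /fa.
rewrite /= row_mxEr; under eq_fun do rewrite row_mxEr.
by move=> V /(@coord_continuous _ _ _ 0 k b) /gb.
Qed.

Lemma continuous_colsub m n (s : 'I_m -> 'I_n) :
  continuous (fun z : 'rV[R]_n => colsub s z).
Proof.
move=> z; apply: (@cvg_rV _ (nbhs z)) => j; rewrite mxE.
under eq_fun do rewrite mxE.
exact: coord_continuous.
Qed.

Lemma open_preimage_at (M N : topologicalType) (D : set M) (f : M -> N) V :
  open D -> (forall x, D x -> {for x, continuous f}) -> open V ->
  open [set x | D x /\ V (f x)].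
Proof.
move=> oD fc oV; rewrite openE => x [Dx Vfx].
apply: filterI; first exact: open_nbhs_nbhs.
by apply: (fc x Dx); exact: open_nbhs_nbhs.
Qed.

Lemma Cdiff_sub m n k (U V : set 'rV[R]_m) (f : 'rV[R]_m -> 'rV[R]_n) :
  V `<=` U -> Cdiff k U f -> Cdiff k V f.
Proof.
move=> VU; elim: k f => [|k IHk] f [fc fk];
  first by split; [move=> x /VU/fc|exact: I].
split=> [x /VU/fc//|i].
by have [df Df] := fk i; split=> [x /VU/df//|]; exact: IHk.
Qed.

(** On an open set the two functions agree near each point, so their partial derivatives agree on
    the set as well and the induction passes to them. *)
Lemma Cdiff_eq m n k (U : set 'rV[R]_m) (f g : 'rV[R]_m -> 'rV[R]_n) :
  open U -> (forall x, U x -> f x = g x) -> Cdiff k U f -> Cdiff k U g.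
Proof.
move=> oU.
have nU (h1 h2 : 'rV[R]_m -> 'rV[R]_n) x :
    (forall x, U x -> h1 x = h2 x) -> U x -> \forall y \near x, h1 y = h2 y.
  by move=> h12 Ux; apply: filterS h12 _; exact: open_nbhs_nbhs.
have cU (h1 h2 : 'rV[R]_m -> 'rV[R]_n) : (forall x, U x -> h1 x = h2 x) ->
    (forall x, U x -> {for x, continuous h1}) ->
    forall x, U x -> {for x, continuous h2}.
  move=> h12 hc x Ux; rewrite /prop_for /continuous_at -(h12 x Ux).
  by apply: cvg_trans (hc x Ux); apply: (@near_eq_cvg _ _ (nbhs x)); exact: nU.
elim: k f g => [|k IHk] f g fg [fc fk]; first by split; [exact: cU fc|exact: I].
split=> [|i]; first exact: cU fc.
have [df Df] := fk i; split=> [x Ux|].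
  by apply: near_eq_derivable (df x Ux); exact: nU.
by apply: IHk Df => x Ux; apply: near_eq_derive; exact: nU.
Qed.

Lemma Cdiff_cst m n k (U : set 'rV[R]_m) (a : 'rV[R]_n) : Cdiff k U (fun=> a).
Proof.
elim: k a => [|k IHk] a;
  first by split; [move=> x _; exact: cst_continuous|exact: I].
split=> [x _|i]; first exact: cst_continuous.
split=> [x _|]; first exact: derivable_cst.
suff -> : (fun x => 'D_(delta_mx 0 i) (fun _ : 'rV[R]_m => a) x) =
  fun=> 0 by exact: IHk.
by apply/funext => x; exact: derive_cst.
Qed.

Lemma is_derive_row_mx p m n (f : 'rV[R]_p -> 'rV[R]_m)
    (g : 'rV[R]_p -> 'rV[R]_n) x v :
  derivable f x v -> derivable g x v ->
  derivable (fun z => row_mx (f z) (g z)) x v /\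
  'D_v (fun z => row_mx (f z) (g z)) x = row_mx ('D_v f x) ('D_v g x).
Proof.
move=> df dg.
have h : (fun h => h^-1 *: (row_mx (f (h *: v + x)) (g (h *: v + x)) -
    row_mx (f x) (g x))) @ 0^' --> row_mx ('D_v f x) ('D_v g x).
  under eq_fun do rewrite opp_row_mx add_row_mx scale_row_mx.
  exact: (@cvg_row_mx _ (0^') _ _ _ _ _ _ _ df dg).
split; first by apply/cvg_ex; exists (row_mx ('D_v f x) ('D_v g x)).
exact/cvg_lim.
Qed.

Lemma Cdiff_row_mx p m n k (U : set 'rV[R]_p) (f : 'rV[R]_p -> 'rV[R]_m)
    (g : 'rV[R]_p -> 'rV[R]_n) :
  open U -> Cdiff k U f -> Cdiff k U g ->
  Cdiff k U (fun z => row_mx (f z) (g z)).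
Proof.
move=> oU; elim: k f g => [|k IHk] f g [fc fk] [gc gk].
  by split; [move=> x Ux|exact: I];
    exact: (@cvg_row_mx _ (nbhs x) _ _ _ _ _ _ _ (fc x Ux) (gc x Ux)).
split=> [x Ux|i].
  exact: (@cvg_row_mx _ (nbhs x) _ _ _ _ _ _ _ (fc x Ux) (gc x Ux)).
have [df Df] := fk i; have [dg Dg] := gk i; split=> [x Ux|].
  by have [] := is_derive_row_mx (df x Ux) (dg x Ux).
apply: (@Cdiff_eq _ _ _ _ _ _ oU _ (IHk _ _ Df Dg)) => x Ux.
by have [_ ->] := is_derive_row_mx (df x Ux) (dg x Ux).
Qed.

(* Coordinate selections map each coordinate direction to a coordinate
   direction or to 0, so no chain rule is needed. *)
Lemma Cdiff_colsub p m n k (s : 'I_m -> 'I_p) (U : set 'rV[R]_m)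
    (f : 'rV[R]_m -> 'rV[R]_n) :
  injective s -> Cdiff k U f ->
  Cdiff k [set z | U (colsub s z)] (fun z => f (colsub s z)).
Proof.
move=> si.
have sc (h : 'rV[R]_m -> 'rV[R]_n) : (forall x, U x -> {for x, continuous h}) ->
    forall x, U (colsub s x) -> {for x, continuous (fun z => h (colsub s z))}.
  move=> hc x Ux; apply: (@continuous_comp _ _ _ (fun z => colsub s z) h).
    exact: continuous_colsub.
  exact: hc.
elim: k f => [|k IHk] f [fc fk]; first by split; [exact: sc|exact: I].
split=> [|i]; first exact: sc.
have quot v x :
    (fun h : R => h^-1 *: (f (colsub s (h *: v + x)) - f (colsub s x))) =
    (fun h => h^-1 *: (f (h *: colsub s v + colsub s x) - f (colsub s x))).
  by apply/funext => h; congr (_ *: (f _ - _)); apply/rowP => j; rewrite !mxE.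
have [[j ->]|ns] := pselect (exists j, i = s j).
  have sd : colsub s (delta_mx 0 (s j) : 'rV[R]_p) = delta_mx 0 j.
    by apply/rowP => l; rewrite !mxE (inj_eq si).
  have [df Df] := fk j; split=> [x Ux|].
    by rewrite /derivable [X in X @ _]quot sd; exact: df.
  suff -> : (fun x => 'D_(delta_mx 0 (s j)) (fun z => f (colsub s z)) x) =
    (fun x => 'D_(delta_mx 0 j) f (colsub s x)) by exact: (IHk _ Df).
  by apply/funext => x; rewrite /derive quot sd.
have sd : colsub s (delta_mx 0 i : 'rV[R]_p) = 0.
  apply/rowP => l; rewrite !mxE eqxx /=; case: eqP => // e.
  by case: ns; exists l.
split=> [x Ux|].
  by rewrite /derivable [X in X @ _]quot sd;
    exact: (@derivable0 _ _ _ f (colsub s x)).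
suff -> : (fun x => 'D_(delta_mx 0 i) (fun z => f (colsub s z)) x) = fun=> 0.
  exact: Cdiff_cst.
apply/funext => x; rewrite /derive quot sd.
exact: (@derive0 _ _ _ f (colsub s x)).
Qed.

End Calculus.

(** This and the two lemmas that follow serve [Cdiff_row_mx], which requires the domain of a
    coordinate expression to be open. *)
Lemma open_transition (R : realType) (M : topologicalType) n
    (c d : chart R M n) :
  open [set y | ccod c y /\ cdom d (cinv c y)].
Proof.
apply: open_preimage_at; [exact: ccod_open|exact: cinv_cts|exact: cdom_open].
Qed.

Lemma open_transition_inv (R : realType) (H : topGroupType) n
    (c d : chart R H n) :
  open [set y | ccod c y /\ cdom d (cinv c y)^-1].
Proof.
apply: (@open_preimage_at _ _ (ccod c) (fun y => (cinv c y)^-1)).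
- exact: ccod_open.
- move=> y cy; apply: (@continuous_comp _ _ _ (cinv c) (fun x => x^-1)).
    exact: cinv_cts.
  exact: invg_continuous.
- exact: cdom_open.
Qed.

Lemma open_transition_mul (R : realType) (H : topGroupType) n
    (c d e : chart R H n) :
  open [set z : 'rV[R]_(n + n) | [/\ ccod c (lsubmx z), ccod d (rsubmx z) &
    cdom e (cinv c (lsubmx z) * cinv d (rsubmx z))]].
Proof.
rewrite (_ : mkset _ = [set z : 'rV[R]_(n + n) |
    (ccod c (lsubmx z) /\ ccod d (rsubmx z)) /\
    cdom e (cinv c (lsubmx z) * cinv d (rsubmx z))]); last first.
  by apply/seteqP; split=> z; [case|case=> -[]].
apply: (@open_preimage_at _ _
  [set z : 'rV[R]_(n + n) | ccod c (lsubmx z) /\ ccod d (rsubmx z)]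
  (fun z => cinv c (lsubmx z) * cinv d (rsubmx z))).
- apply: openI; apply: open_comp; try exact: ccod_open.
    by move=> x _; exact: continuous_lsubmx.
  by move=> x _; exact: continuous_rsubmx.
- move=> z [cz dz]; apply: continuous_mulg_at.
    apply: (@continuous_comp _ _ _ (@lsubmx R 1 n n) (cinv c)).
      exact: continuous_lsubmx.
    exact: cinv_cts.
  apply: (@continuous_comp _ _ _ (@rsubmx R 1 n n) (cinv d)).
    exact: continuous_rsubmx.
  exact: cinv_cts.
- exact: cdom_open.
Qed.

(** * Product charts and their smoothness *)

Section ProductChart.
Context {R : realType} (G G1 G2 : topGroupType).
Context (p1 : G -> G1) (p2 : G -> G2) (q : G1 * G2 -> G).
Context (p1h : top_hom p1) (p2h : top_hom p2) (qc : continuous q).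
Context (p1q : forall z, p1 (q z) = z.1) (p2q : forall z, p2 (q z) = z.2).
Context (qp : forall g, q (p1 g, p2 g) = g).
Context (n1 n2 : nat).

Section Chart.
Context (c1 : chart R G1 n1) (c2 : chart R G2 n2).

Let dom := [set g | cdom c1 (p1 g) /\ cdom c2 (p2 g)].
Let cod : set 'rV[R]_(n1 + n2) :=
  [set y | ccod c1 (lsubmx y) /\ ccod c2 (rsubmx y)].
Let f (g : G) : 'rV[R]_(n1 + n2) := row_mx (cmap c1 (p1 g)) (cmap c2 (p2 g)).
Let f' (y : 'rV[R]_(n1 + n2)) : G := q (cinv c1 (lsubmx y), cinv c2 (rsubmx y)).

Let dom_open : open dom.
Proof.
apply: openI; apply: open_comp; try exact: cdom_open.
  by move=> x _; exact: (proj2 p1h).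
by move=> x _; exact: (proj2 p2h).
Qed.

Let cod_open : open cod.
Proof.
apply: openI; apply: open_comp; try exact: ccod_open.
  by move=> x _; exact: continuous_lsubmx.
by move=> x _; exact: continuous_rsubmx.
Qed.

Let f_cod x : dom x -> cod (f x).
Proof.
by move=> [x1 x2]; split; rewrite ?row_mxKl ?row_mxKr; exact: cmap_cod.
Qed.

Let f'_dom y : cod y -> dom (f' y).
Proof. by move=> [y1 y2]; split; rewrite ?p1q ?p2q; exact: cinv_dom. Qed.

Let fK x : dom x -> f' (f x) = x.
Proof. by move=> [x1 x2]; rewrite /f' /f row_mxKl row_mxKr !cmapK. Qed.

Let f'K y : cod y -> f (f' y) = y.
Proof. by move=> [y1 y2]; rewrite /f' /f p1q p2q !cinvK // hsubmxK. Qed.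

Let f_cts x : dom x -> {for x, continuous f}.
Proof.
move=> [x1 x2]; apply: (@cvg_row_mx _ _ (nbhs x)).
  apply: (@continuous_comp _ _ _ p1 (cmap c1) x); first exact: (proj2 p1h).
  exact: cmap_cts.
apply: (@continuous_comp _ _ _ p2 (cmap c2) x); first exact: (proj2 p2h).
exact: cmap_cts.
Qed.

Let f'_cts y : cod y -> {for y, continuous f'}.
Proof.
move=> [y1 y2].
apply: (@continuous_comp _ _ _
  (fun y => (cinv c1 (lsubmx y), cinv c2 (rsubmx y))) q); last exact: qc.
apply: continuous_pair_at.
  apply: (@continuous_comp _ _ _ (@lsubmx R 1 n1 n2) (cinv c1)).
    exact: continuous_lsubmx.
  exact: cinv_cts.
apply: (@continuous_comp _ _ _ (@rsubmx R 1 n1 n2) (cinv c2)).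
  exact: continuous_rsubmx.
exact: cinv_cts.
Qed.

Definition prod_chart : chart R G (n1 + n2) :=
  Chart dom_open cod_open f_cod f'_dom fK f'K f_cts f'_cts.

End Chart.

Let prod_chart_map c1 c2 g :
  cmap (prod_chart c1 c2) g = row_mx (cmap c1 (p1 g)) (cmap c2 (p2 g)).
Proof. by []. Qed.

Let prod_chart_inv c1 c2 y :
  cinv (prod_chart c1 c2) y = q (cinv c1 (lsubmx y), cinv c2 (rsubmx y)).
Proof. by []. Qed.

Definition prod_atlas (A1 : set (chart R G1 n1)) (A2 : set (chart R G2 n2)) :
    set (chart R G (n1 + n2)) :=
  [set c | exists c1 c2, [/\ A1 c1, A2 c2 & c = prod_chart c1 c2]].

Let smooth_row_mx p m n (U : set 'rV[R]_p) (f : 'rV[R]_p -> 'rV[R]_m)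
    (g : 'rV[R]_p -> 'rV[R]_n) :
  open U -> smooth_on U f -> smooth_on U g ->
  smooth_on U (fun z => row_mx (f z) (g z)).
Proof. by move=> oU fs gs k; exact: Cdiff_row_mx. Qed.

Let smooth_colsub p m n (s : 'I_m -> 'I_p) (U : set 'rV[R]_m) (V : set 'rV[R]_p)
    (f : 'rV[R]_m -> 'rV[R]_n) :
  injective s -> V `<=` [set z | U (colsub s z)] -> smooth_on U f ->
  smooth_on V (fun z => f (colsub s z)).
Proof. by move=> si VU fs k; apply: (Cdiff_sub VU); exact: Cdiff_colsub. Qed.

Let colsub_lshift (y : 'rV[R]_(n1 + n2)) : colsub (@lshift n1 n2) y = lsubmx y.
Proof. by apply/rowP => j; rewrite !mxE. Qed.

Let colsub_rshift (y : 'rV[R]_(n1 + n2)) : colsub (@rshift n1 n2) y = rsubmx y.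
Proof. by apply/rowP => j; rewrite !mxE. Qed.

(** A transition map between product charts is the row formed by the transition maps of the factors,
    each precomposed with the selection of its own block of coordinates. Inversion and
    multiplication are treated in the same way. *)
Lemma prod_smooth_atlas A1 A2 :
  smooth_atlas A1 -> smooth_atlas A2 -> smooth_atlas (prod_atlas A1 A2).
Proof.
move=> [cov1 tr1] [cov2 tr2];
  split=> [x|_ _ [c1 [c2 [Ac1 Ac2 ->]]] [d1 [d2 [Ad1 Ad2 ->]]]].
  have [c1 Ac1 c1x] := cov1 (p1 x); have [c2 Ac2 c2x] := cov2 (p2 x).
  by exists (prod_chart c1 c2) => //; exists c1, c2.
rewrite (_ : (fun y => _) = (fun y : 'rV[R]_(n1 + n2) => row_mx
  (cmap d1 (cinv c1 (colsub (@lshift n1 n2) y)))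
  (cmap d2 (cinv c2 (colsub (@rshift n1 n2) y))))); last first.
  apply/funext => y.
  by rewrite prod_chart_map prod_chart_inv p1q p2q colsub_lshift colsub_rshift.
apply: smooth_row_mx; first exact: open_transition.
  apply: smooth_colsub (tr1 _ _ Ac1 Ad1); first exact: lshift_inj.
  move=> y [[y1 y2] [y3 y4]] /=; rewrite colsub_lshift; split=> //.
  by move: y3; rewrite prod_chart_inv p1q.
apply: smooth_colsub (tr2 _ _ Ac2 Ad2); first exact: rshift_inj.
move=> y [[y1 y2] [y3 y4]] /=; rewrite colsub_rshift; split=> //.
by move: y4; rewrite prod_chart_inv p2q.
Qed.

Let p1V x : p1 x^-1 = (p1 x)^-1.
Proof.
by apply: (@mulgI _ (p1 x)); rewrite -(proj1 p1h) !mulgV (top_hom1 p1h).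
Qed.

Let p2V x : p2 x^-1 = (p2 x)^-1.
Proof.
by apply: (@mulgI _ (p2 x)); rewrite -(proj1 p2h) !mulgV (top_hom1 p2h).
Qed.

Lemma prod_smooth_inv A1 A2 :
  smooth_inv A1 -> smooth_inv A2 -> smooth_inv (prod_atlas A1 A2).
Proof.
move=> tr1 tr2 _ _ [c1 [c2 [Ac1 Ac2 ->]]] [d1 [d2 [Ad1 Ad2 ->]]].
rewrite (_ : (fun y => _) = (fun y : 'rV[R]_(n1 + n2) => row_mx
  (cmap d1 (cinv c1 (colsub (@lshift n1 n2) y))^-1)
  (cmap d2 (cinv c2 (colsub (@rshift n1 n2) y))^-1))); last first.
  apply/funext => y.
  by rewrite prod_chart_map prod_chart_inv p1V p2V p1q p2q colsub_lshift
    colsub_rshift.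
apply: smooth_row_mx; first exact: open_transition_inv.
  apply: smooth_colsub (tr1 _ _ Ac1 Ad1); first exact: lshift_inj.
  move=> y [[y1 y2] [y3 y4]] /=; rewrite colsub_lshift; split=> //.
  by move: y3; rewrite prod_chart_inv p1V p1q.
apply: smooth_colsub (tr2 _ _ Ac2 Ad2); first exact: rshift_inj.
move=> y [[y1 y2] [y3 y4]] /=; rewrite colsub_rshift; split=> //.
by move: y4; rewrite prod_chart_inv p2V p2q.
Qed.

(* [sel1] and [sel2] read the coordinates of the first (second) factor off a
   pair of points of the product. *)
Let sel1 (k : 'I_(n1 + n1)) : 'I_((n1 + n2) + (n1 + n2)) :=
  match fintype.split k with
  | inl j => lshift _ (lshift _ j)
  | inr j => rshift _ (lshift _ j)
  end.

Let sel2 (k : 'I_(n2 + n2)) : 'I_((n1 + n2) + (n1 + n2)) :=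
  match fintype.split k with
  | inl j => lshift _ (rshift _ j)
  | inr j => rshift _ (rshift _ j)
  end.

Let sel1_inj : injective sel1.
Proof.
move=> k l; rewrite /sel1 -[k]splitK -[l]splitK !unsplitK.
case: (fintype.split k) (fintype.split l) => i [] j e; congr unsplit.
- by rewrite (lshift_inj (lshift_inj e)).
- by move/eqP: e; rewrite eq_lrshift.
- by move/eqP: e; rewrite eq_rlshift.
- by rewrite (lshift_inj (rshift_inj e)).
Qed.

Let sel2_inj : injective sel2.
Proof.
move=> k l; rewrite /sel2 -[k]splitK -[l]splitK !unsplitK.
case: (fintype.split k) (fintype.split l) => i [] j e; congr unsplit.
- by rewrite (rshift_inj (lshift_inj e)).
- by move/eqP: e; rewrite eq_lrshift.
- by move/eqP: e; rewrite eq_rlshift.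
- by rewrite (rshift_inj (rshift_inj e)).
Qed.

Let sel1l (z : 'rV[R]_((n1 + n2) + (n1 + n2))) :
  lsubmx (colsub sel1 z) = lsubmx (lsubmx z).
Proof. by apply/rowP => j; rewrite !mxE /sel1 (@unsplitK _ _ (inl j)). Qed.

Let sel1r (z : 'rV[R]_((n1 + n2) + (n1 + n2))) :
  rsubmx (colsub sel1 z) = lsubmx (rsubmx z).
Proof. by apply/rowP => j; rewrite !mxE /sel1 (@unsplitK _ _ (inr j)). Qed.

Let sel2l (z : 'rV[R]_((n1 + n2) + (n1 + n2))) :
  lsubmx (colsub sel2 z) = rsubmx (lsubmx z).
Proof. by apply/rowP => j; rewrite !mxE /sel2 (@unsplitK _ _ (inl j)). Qed.

Let sel2r (z : 'rV[R]_((n1 + n2) + (n1 + n2))) :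
  rsubmx (colsub sel2 z) = rsubmx (rsubmx z).
Proof. by apply/rowP => j; rewrite !mxE /sel2 (@unsplitK _ _ (inr j)). Qed.

Lemma prod_smooth_mul A1 A2 :
  smooth_mul A1 -> smooth_mul A2 -> smooth_mul (prod_atlas A1 A2).
Proof.
move=> tr1 tr2 _ _ _ [c1 [c2 [Ac1 Ac2 ->]]] [d1 [d2 [Ad1 Ad2 ->]]]
  [e1 [e2 [Ae1 Ae2 ->]]] f.
rewrite (_ : (fun y => _) = (fun z : 'rV[R]_((n1 + n2) + (n1 + n2)) => row_mx
  (cmap e1 (cinv c1 (lsubmx (colsub sel1 z)) *
            cinv d1 (rsubmx (colsub sel1 z))))
  (cmap e2 (cinv c2 (lsubmx (colsub sel2 z)) *
            cinv d2 (rsubmx (colsub sel2 z))))));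
    last first.
  apply/funext => z; rewrite prod_chart_map /f !prod_chart_inv.
  by rewrite (proj1 p1h) (proj1 p2h) !p1q !p2q sel1l sel1r sel2l sel2r.
apply: smooth_row_mx; first exact: open_transition_mul.
  apply: (smooth_colsub sel1_inj _ (tr1 _ _ _ Ac1 Ad1 Ae1)).
  move=> z [[z1 z2] [z3 z4] [z5 z6]] /=; rewrite sel1l sel1r; split=> //.
  by move: z5; rewrite /f !prod_chart_inv (proj1 p1h) !p1q.
apply: (smooth_colsub sel2_inj _ (tr2 _ _ _ Ac2 Ad2 Ae2)).
move=> z [[z1 z2] [z3 z4] [z5 z6]] /=; rewrite sel2l sel2r; split=> //.
by move: z6; rewrite /f !prod_chart_inv (proj1 p2h) !p2q.
Qed.

End ProductChart.

(* [q] makes [G] the product of [G1] and [G2]; the product type itself carries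
   no group structure. *)
Lemma is_Lie_group_prod2 (R : realType) (G G1 G2 : topGroupType)
    (p1 : G -> G1) (p2 : G -> G2) (q : G1 * G2 -> G) :
  top_hom p1 -> top_hom p2 -> continuous q ->
  (forall z, p1 (q z) = z.1) -> (forall z, p2 (q z) = z.2) ->
  (forall g, q (p1 g, p2 g) = g) ->
  is_Lie_group R G1 -> is_Lie_group R G2 -> is_Lie_group R G.
Proof.
move=> p1h p2h qc p1q p2q qp [H1 [n1 [A1 [at1 mul1 inv1]]]].
move=> [H2 [n2 [A2 [at2 mul2 inv2]]]].
split.
  move=> x y xy; rewrite -(qp x) -(qp y); congr (q (_, _)).
    apply: H1 => U V Ux Vy.
    by have [z [Uz Vz]] := xy _ _ (proj2 p1h x U Ux) (proj2 p1h y V Vy);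
      exists (p1 z).
  apply: H2 => U V Ux Vy.
  by have [z [Uz Vz]] := xy _ _ (proj2 p2h x U Ux) (proj2 p2h y V Vy);
    exists (p2 z).
exists (n1 + n2)%N, (prod_atlas p1h p2h qc p1q p2q qp A1 A2); split.
- exact: prod_smooth_atlas.
- exact: prod_smooth_mul.
- exact: prod_smooth_inv.
Qed.

(** One chart onto the single point of ['rV[R]_0] suffices, and every coordinate expression is
    constant. *)
Lemma is_Lie_group_trivial (R : realType) (G : topGroupType) :
  (forall x : G, x = 1) -> is_Lie_group R G.
Proof.
move=> G1; split; first by move=> x y _; rewrite (G1 x) (G1 y).
have c1 x : @setT G x ->
    (fun _ : 'rV[R]_0 => 1 : G) ((fun _ : G => 0%R) x) = x.
  by rewrite [RHS]G1.
have c2 (y : 'rV[R]_0) : setT y ->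
    (fun _ : G => 0%R) ((fun _ : 'rV[R]_0 => 1 : G) y) = y.
  by move=> _; rewrite [RHS]thinmx0.
have cc (T U : topologicalType) (u : U) (t : T) : setT t ->
    {for t, continuous (fun=> u)}.
  by move=> _; exact: cst_continuous.
pose c := @Chart R G 0 setT setT _ _ openT openT (fun _ _ => I) (fun _ _ => I)
  c1 c2 (@cc _ _ _) (@cc _ _ _).
exists 0%N, [set c]; split.
- split=> [x|_ _ -> -> k]; first by exists c.
  exact: Cdiff_cst.
- by move=> _ _ _ -> -> -> f k; exact: Cdiff_cst.
- by move=> _ _ -> -> k; exact: Cdiff_cst.
Qed.

Lemma is_Lie_group_finite_prod (R : realType) (J : Type) (B : J -> topGroupType)
    (F : set J) :
  finite_set F -> (forall j, is_Lie_group R (B j)) ->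
  is_Lie_group R (prod_topology (fun i : {j | F j} => B (sval i))).
Proof.
move=> + BL; elim/finite_set_ind => {F} [|F a _ nFa IHF].
  by apply: is_Lie_group_trivial => x;
    apply: functional_extensionality_dep => -[].
pose A (F' : set J) (i : {j | F' j}) := B (sval i).
pose ia : {j | (a |` F) j} := exist _ a (or_introl erefl).
pose inc (i : {j | F j}) : {j | (a |` F) j} :=
  exist _ (sval i) (or_intror (proj2_sig i)).
pose p1 (x : prod_topology (A (a |` F))) : B a := x ia.
pose p2 (x : prod_topology (A (a |` F))) : prod_topology (A F) :=
  fun i => x (inc i).
have F_of j (ja : j <> a) (Fj : (a |` F) j) : F j by case: Fj.
(* At the index [a] the entry [z.1] must be transported from [B a] to [B (sval i)]; the membership
   proofs inside the other indices are identified by proof irrelevance. *)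
pose q (z : B a * prod_topology (A F)) : prod_topology (A (a |` F)) := fun i =>
  match pselect (sval i = a) return B (sval i) with
  | left e => eq_rect a B z.1 (sval i) (esym e)
  | right ne => z.2 (exist _ (sval i) (F_of _ ne (proj2_sig i)))
  end.
apply: (@is_Lie_group_prod2 R _ (B a) (prod_topology (A F)) p1 p2 q) => //.
- exact: (@top_hom_proj _ (A (a |` F)) ia).
- by apply: top_hom_into_prod => i;
    exact: (@top_hom_proj _ (A (a |` F)) (inc i)).
- apply: into_prod_cts => -[j Fj]; rewrite /q /=.
  case: (pselect (j = a)) => [e|ne]; first by subst j => z; exact: cvg_fst.
  pose k : {j | F j} := exist _ j (F_of j ne Fj).
  move=> z.
  apply: (@continuous_comp _ _ _ snd (fun x : prod_topology (A F) => x k)).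
    exact: cvg_snd.
  exact: proj_cts.
- move=> z; rewrite /p1 /q /=; case: pselect => // e.
  by rewrite (Prop_irrelevance (esym e) erefl).
- move=> z; apply: functional_extensionality_dep => -[j Fj]; rewrite /p2 /q /=.
  case: pselect => [e|ne]; first by case: nFa; rewrite -e.
  by congr (z.2 (exist _ j _)); exact: Prop_irrelevance.
- move=> x; apply: functional_extensionality_dep => -[j Fj];
    rewrite /q /p1 /p2 /=.
  case: pselect => [e|ne].
    subst j; rewrite /ia /=.
    by congr (x (exist _ a _)); exact: Prop_irrelevance.
  by congr (x (exist _ j _)); exact: Prop_irrelevance.
Qed.

(** * Absence of small subgroups *)

Section NoSmallSubgroups.
Local Open Scope ring_scope.
Context {R : realType}.

Definition set_coord n (y : 'rV[R]_n) (j : 'I_n) (u : R) : 'rV[R]_n :=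
  \row_i (if i == j then u else y 0 i).

Lemma is_derive_set_coord n (f : 'rV[R]_n -> R) y (j : 'I_n) (u : R) :
  derivable f (set_coord y j u) (delta_mx 0 j) ->
  is_derive u 1 (fun t => f (set_coord y j t))
    ('D_(delta_mx 0 j) f (set_coord y j u)).
Proof.
move=> df.
have quot :
    (fun h : R =>
       h^-1 *: (f (set_coord y j (h *: 1 + u)) - f (set_coord y j u))) =
    (fun h =>
       h^-1 *: (f (h *: delta_mx 0 j + set_coord y j u) -
                f (set_coord y j u))).
  apply/funext => h; congr (_ *: (f _ - _)); apply/rowP => i;
    rewrite !mxE eqxx /=.
  by case: eqP => _; rewrite ?scaler0 ?add0r //= mulr0 add0r.
by split; rewrite ?/derivable ?/derive /= quot.
Qed.

(** The mean value theorem along the [j]-th coordinate line through [y]. *)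
Lemma lipschitz_set_coord n (f : 'rV[R]_n -> R) y (j : 'I_n) (e s t : R) :
  s <= t ->
  (forall u, s <= u <= t -> derivable f (set_coord y j u) (delta_mx 0 j) /\
     `|'D_(delta_mx 0 j) f (set_coord y j u)| <= e) ->
  `|f (set_coord y j t) - f (set_coord y j s)| <= e * (t - s).
Proof.
move=> st df.
have d u : s <= u <= t -> is_derive u 1 (fun t => f (set_coord y j t))
    ('D_(delta_mx 0 j) f (set_coord y j u)).
  by move=> /df[du _]; exact: is_derive_set_coord.
have dw u : u \in `]s, t[%R -> is_derive u 1 (fun t => f (set_coord y j t))
    ('D_(delta_mx 0 j) f (set_coord y j u)).
  by rewrite in_itv /= => /andP[su ut]; apply: d; rewrite !ltW.
have cw : {within `[s, t], continuous (fun t => f (set_coord y j t))}.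
  apply: derivable_within_continuous => u; rewrite in_itv /= => ust.
  by have [] := d u ust.
have [c] := MVT_segment st dw cw; rewrite in_itv /= => cst ->.
rewrite normrM [`|t - s|]ger0_norm ?subr_ge0 // ler_wpM2r ?subr_ge0 //.
by have [] := df c cst.
Qed.

(** One goes from [y] to [z] by changing one coordinate at a time. All intermediate points stay in
    the box around [a], and each of the [n] moves costs at most [e * d]. *)
Lemma lipschitz_box n (f : 'rV[R]_n -> R) (a : 'rV[R]_n) (r e d : R) :
  (forall y : 'rV[R]_n, (forall i, `|y 0 i - a 0 i| < r) -> forall j : 'I_n,
     derivable f y (delta_mx 0 j) /\ `|'D_(delta_mx 0 j) f y| <= e) ->
  forall y z : 'rV[R]_n,
    (forall i, `|y 0 i - a 0 i| < r) -> (forall i, `|z 0 i - a 0 i| < r) ->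
    (forall i, `|y 0 i - z 0 i| <= d) ->
  `|f y - f z| <= n%:R * (e * d).
Proof.
move=> df y z ya za yz.
(* Induction on the number [k] of leading coordinates in which [y] and [z] may still differ. *)
have step k : (k <= n)%N -> forall y : 'rV[R]_n,
    (forall i, `|y 0 i - a 0 i| < r) ->
    (forall i, `|y 0 i - z 0 i| <= d) ->
    (forall i : 'I_n, (k <= i)%N -> y 0 i = z 0 i) ->
    `|f y - f z| <= k%:R * (e * d).
  elim: k => [_ {ya yz} y _ _ yz|k IHk kn {ya yz} y ya yd yz].
    rewrite (_ : y = z) ?subrr ?normr0 ?mul0r //.
    by apply/rowP => i; exact: yz.
  pose j := Ordinal kn; pose y' := set_coord y j (z 0 j).
  have yE : y = set_coord y j (y 0 j).
    by apply/rowP => i; rewrite mxE; case: eqP => [->|].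
  have box u : (`|u - a 0 j| < r) ->
      forall i, `|set_coord y j u 0 i - a 0 i| < r.
    by move=> ur i; rewrite mxE; case: eqP => [->|].
  have fyy' : `|f y - f y'| <= e * d.
    have ub u s t : `|s - a 0 j| < r -> `|t - a 0 j| < r -> s <= u <= t ->
        derivable f (set_coord y j u) (delta_mx 0 j) /\
        `|'D_(delta_mx 0 j) f (set_coord y j u)| <= e.
      rewrite !ltr_norml => /andP[s1 s2] /andP[t1 t2] /andP[su ut].
      by apply: df; apply: box; rewrite ltr_norml; lra.
    have e0 : 0 <= e.
      by apply: le_trans (proj2 (df y ya j)); exact: normr_ge0.
    have [le|/ltW le] := leP (y 0 j) (z 0 j).
      rewrite distrC [X in f y' - f X]yE.
      apply: le_trans (lipschitz_set_coord le (fun u h =>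
        ub u _ _ (ya j) (za j) h)) _.
      by apply: ler_wpM2l => //; apply: le_trans (yd j);
        rewrite distrC ler_norm.
    rewrite [X in f X - f y']yE.
    apply: le_trans (lipschitz_set_coord le (fun u h =>
      ub u _ _ (za j) (ya j) h)) _.
    by apply: ler_wpM2l => //; apply: le_trans (yd j); rewrite ler_norm.
  have -> : f y - f z = (f y' - f z) + (f y - f y') by ring.
  rewrite -natr1 mulrDl mul1r; apply: le_trans (ler_normD _ _) _.
  apply: lerD => //; apply: IHk; first exact: ltnW.
  - by apply: box.
  - move=> i; rewrite mxE; case: eqP => [->|_]; last exact: yd.
    by rewrite subrr normr0; apply: le_trans (yd j).
  - move=> i ki; rewrite mxE; case: eqP => [->//|/eqP ij].
    apply: yz; rewrite ltn_neqAle ki andbT.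
    by apply: contra ij => /eqP ij; apply/eqP/val_inj.
by apply: (step n) => // i; rewrite leqNgt ltn_ord.
Qed.

Lemma nbhs_boxP n (a : 'rV[R]_n) (N : set 'rV[R]_n) :
  nbhs a N <-> exists2 r : R, 0 < r &
    forall y : 'rV[R]_n, (forall i, `|y 0 i - a 0 i| < r) -> N y.
Proof.
split=> [/nbhs_ballP[r r0 rN]|[r r0 rN]].
  exists r => // y ya; apply: rN; split=> // i j.
  by rewrite (ord1 i) /ball /= distrC; exact: ya.
apply/nbhs_ballP; exists r => // y [_ ya]; apply: rN => j.
by have := ya 0 j; rewrite /ball /= distrC.
Qed.

Lemma derive_sub_id (V : normedModType R) (f : V -> V) (x v : V) :
  derivable f x v ->
  derivable (fun y => f y - y) x v /\ 'D_v (fun y => f y - y) x = 'D_v f x - v.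
Proof.
move=> df; split; first exact: (derivableB df (@derivable_id _ _ x v)).
by rewrite (deriveB df (@derivable_id _ _ x v)) derive_id.
Qed.

Lemma derive_row_mx_r m n p (F : 'rV[R]_(m + n) -> 'rV[R]_p) x y (j : 'I_n) :
  derivable F (row_mx x y) (delta_mx 0 (rshift m j)) ->
  derivable (fun y => F (row_mx x y)) y (delta_mx 0 j) /\
  'D_(delta_mx 0 j) (fun y => F (row_mx x y)) y =
    'D_(delta_mx 0 (rshift m j)) F (row_mx x y).
Proof.
have quot :
    (fun h : R =>
       h^-1 *: (F (row_mx x (h *: delta_mx 0 j + y)) - F (row_mx x y))) =
    (fun h =>
       h^-1 *: (F (h *: delta_mx 0 (rshift m j) + row_mx x y) -
                F (row_mx x y))).
  apply/funext => h; congr (_ *: (F _ - _)).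
  have -> : delta_mx 0 (rshift m j) = row_mx 0 (delta_mx 0 j : 'rV[R]_n).
    apply/rowP => i; rewrite -[i]splitK; case: (fintype.split i) => k /=.
      by rewrite row_mxEl !mxE eq_lrshift andbF.
    by rewrite row_mxEr !mxE eq_rshift.
  by rewrite scale_row_mx add_row_mx scaler0 add0r.
by move=> dF; rewrite /derivable /derive /= quot.
Qed.

(* To first order a local multiplication with unit [a] is
   [(x, y) |-> x + y - a], so squaring doubles the displacement from [a]. *)
Lemma local_square_expansion n (U : set 'rV[R]_(n + n))
    (F : 'rV[R]_(n + n) -> 'rV[R]_n) (a : 'rV[R]_n) :
  open U -> U (row_mx a a) -> Cdiff 1 U F ->
  (\forall y \near a, F (row_mx a y) = y) ->
  (\forall y \near a, F (row_mx y a) = y) ->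
  exists2 r : R, 0 < r & forall (x : 'rV[R]_n) (d : R),
    (forall i, `|x 0 i - a 0 i| < r) -> (forall i, `|x 0 i - a 0 i| <= d) ->
    forall l, `|(F (row_mx x x) 0 l - x 0 l) - (x 0 l - a 0 l)| <= d / 2.
Proof.
move=> oU Ua [Fc F1] Fal Far.
have dF i := proj1 (F1 i); have cF i := proj1 (proj2 (F1 i)).
(* Chosen so that the bound [n%:R * (e * d)] of [lipschitz_box] is at most [d / 2]; the successor
   keeps the denominator nonzero when [n] is 0. *)
pose e : R := (2 * n.+1%:R)^-1.
have e0 : 0 < e by rewrite invr_gt0 mulr_gt0 // ltr0n.
(* Near [a] the map sending [y] to [F (row_mx a y)] is the identity, which fixes the partial
   derivatives of the second block; by continuity they stay within [e] of these values nearby. *)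
have da j : 'D_(delta_mx 0 (rshift n j)) F (row_mx a a) = delta_mx 0 j.
  have [_ <-] := derive_row_mx_r (dF (rshift n j) _ Ua).
  by rewrite (near_eq_derive _ Fal) derive_id.
have nearD : \forall z \near row_mx a a, forall j : 'I_n, U z /\
    forall l, `|('D_(delta_mx 0 (rshift n j)) F z - delta_mx 0 j) 0 l| <= e.
  apply: (@filter_forall _ 'I_n _ (nbhs (row_mx a a))) => j.
  apply: filterI; first exact: open_nbhs_nbhs.
  have /nbhs_ballP[s s0 sb] := cF (rshift n j) _ Ua _ (nbhsx_ballx _ _ e0).
  apply/nbhs_ballP; exists s => // z /sb [_ /(_ 0)].
  rewrite da => zl l; have /ltW := zl l.
  by rewrite /ball /= distrC !mxE.
have /nbhs_boxP[r1 r10 r1N] := nearD.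
have /nbhs_boxP[r2 r20 r2N] := Far.
exists (Num.min r1 r2); first by rewrite lt_min r10.
move=> x d xr xd l.
have xr1 i : `|x 0 i - a 0 i| < r1 by have := xr i; rewrite lt_min => /andP[].
have ar1 i : `|a 0 i - a 0 i| < r1 by rewrite subrr normr0.
have boxN (y : 'rV[R]_n) : (forall i, `|y 0 i - a 0 i| < r1) ->
    forall j : 'I_n, U (row_mx x y) /\ forall l,
      `|('D_(delta_mx 0 (rshift n j)) F (row_mx x y) - delta_mx 0 j) 0 l| <= e.
  move=> yr; apply: r1N => i; rewrite -[i]splitK.
  by case: (fintype.split i) => k /=; rewrite ?row_mxEl ?row_mxEr.
(* The partial derivatives of [g] are small. Since [F (row_mx x a) = x], the difference [g x - g a]
   is exactly the quantity to be bounded. *)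
pose g (y : 'rV[R]_n) : R := (F (row_mx x y) - y) 0 l.
have dg (y : 'rV[R]_n) : (forall i, `|y 0 i - a 0 i| < r1) -> forall j : 'I_n,
    derivable g y (delta_mx 0 j) /\ `|'D_(delta_mx 0 j) g y| <= e.
  move=> yr j; have [Uxy De] := boxN y yr j.
  have [dxy Dxy] := derive_row_mx_r (dF (rshift n j) _ Uxy).
  have [dG DG] := derive_sub_id dxy.
  split; first exact: ((proj1 (derivable_mxP _ _ _)) dG).
  by have := De l; rewrite -Dxy -DG (derive_mx dG) mxE.
have := lipschitz_box dg xr1 ar1 xd.
rewrite /g !mxE (r2N x) => [|i];
  last by have := xr i; rewrite lt_min => /andP[].
move=> h; apply: le_trans h _.
have d0 : 0 <= d by apply: le_trans (xd l).
rewrite mulrA mulrC ler_wpM2l // /e ler_pdivrMr ?mulr_gt0 ?ltr0n //.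
by rewrite mulrA mulVf ?mul1r ?ler_nat // pnatr_eq0.
Qed.

(** [U] is the box in a chart at 1 on which [local_square_expansion] holds. Only the powers of [x]
    with exponent [2 ^ k] are followed, since each is the square of the previous one. *)
Lemma Lie_group_no_small_subgroups (G : topGroupType) : is_Lie_group R G ->
  exists2 U : set G, nbhs (1%g : G) U &
    forall x : G, (forall k : nat, U (x ^+ k)%g) -> x = 1%g.
Proof.
move=> [_ [n [At [[cov _] mulA _]]]].
have [c Ac c1] := cov 1%g.
pose a := cmap c 1%g.
pose F (z : 'rV[R]_(n + n)) := cmap c (cinv c (lsubmx z) * cinv c (rsubmx z))%g.
have /= FS := mulA c c c Ac Ac Ac 1%N.
have ca : ccod c a by exact: cmap_cod.
have ia : cinv c a = 1%g by exact: cmapK.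
have na : nbhs a (ccod c) by apply: open_nbhs_nbhs; split=> //;
  exact: ccod_open.
have [||||r r0 rF] := @local_square_expansion n _ F a _ _ FS.
- exact: open_transition_mul.
- by rewrite /= row_mxKl row_mxKr ia mulg1.
- by apply: filterS na => y cy; rewrite /F row_mxKl row_mxKr ia mul1g cinvK.
- by apply: filterS na => y cy; rewrite /F row_mxKl row_mxKr ia mulg1 cinvK.
exists [set g | cdom c g /\ forall i, `|cmap c g 0 i - a 0 i| < r].
  apply: filterI; first by apply: open_nbhs_nbhs; split=> //; exact: cdom_open.
  have nb : nbhs a [set y : 'rV[R]_n | forall i, `|y 0 i - a 0 i| < r].
    by apply/nbhs_boxP; exists r.
  exact: (cmap_cts c1 nb).
move=> x xU; pose X k := cmap c (x ^+ (2 ^ k))%g.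
have XS k : X k.+1 = F (row_mx (X k) (X k)).
  have [xk _] := xU (2 ^ k)%N.
  by rewrite /F row_mxKl row_mxKr cmapK // -expgnDr addnn -mul2n -expnS.
suff X0 : X 0%N = a.
  by have [x1 _] := xU 1%N; rewrite -[LHS](cmapK x1) -[RHS]ia -X0.
apply/rowP => l.
(* With [s] the supremum of all displacements, the expansion bounds twice a displacement of [X k] by
   one of [X k.+1] plus [s / 2], hence by [3 / 2 * s]. So [s <= 3 / 4 * s], which forces all
   displacements to vanish. *)
pose E : set R := [set t | exists k i, t = `|X k 0 i - a 0 i|].
have Eub : has_ubound E by exists r => _ [k [i ->]]; apply/ltW;
  exact: (proj2 (xU _)).
have EX k i : `|X k 0 i - a 0 i| <= sup E by apply: ub_le_sup => //;
  exists k, i.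
have E0 : E !=set0 by exists `|X 0%N 0 l - a 0 l|, 0%N, l.
have : sup E <= 3 / 4 * sup E.
  apply: ge_sup => // _ [k [i ->]].
  have := rF (X k) (sup E) (proj2 (xU _)) (EX k) i; rewrite -XS.
  have := EX k.+1 i; rewrite !ler_norml => /andP[h1 h2] /andP[h3 h4].
  by apply/andP; split; lra.
have := EX 0%N l; have := normr_ge0 (X 0%N 0 l - a 0 l) => h1 h2 h3.
by apply/eqP; rewrite -subr_eq0 -normr_eq0; apply/eqP; lra.
Qed.

End NoSmallSubgroups.

(** * The conditional coproduct *)

Section ProductSystem.
Context (J : Type) (S : J -> proj_system).

(* The system of finite products of the objects of the S j. An index records a
   position in every S j, although only those over its finite set matter, so
   that the order can be compared componentwise. *)
Definition pr_idx : Type :=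
  ({F : set J | finite_set F} * (forall j, ps_idx (S j)))%type.

Definition pr_le (a b : pr_idx) : Prop :=
  sval a.1 `<=` sval b.1 /\ forall j, ps_le (a.2 j) (b.2 j).

Definition pr_obj (a : pr_idx) : topGroupType :=
  prod_topology (fun i : {j | sval a.1 j} => ps_obj (a.2 (sval i))).

Definition pr_map (a b : pr_idx) (ab : pr_le a b) (x : pr_obj b) : pr_obj a :=
  fun i => ps_map (proj2 ab (sval i))
                  (x (exist _ (sval i) (proj1 ab _ (proj2_sig i)))).

Lemma pr_inh : inhabited pr_idx.
Proof.
have s0 j : ps_idx (S j).
  have [s _] : {s : ps_idx (S j) | True} by apply/cid;
    case: (ps_inh (S j)) => s; exists s.
  exact: s.
by constructor; split => //; exists set0.
Qed.

Lemma pr_refl a : pr_le a a.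
Proof. by split=> // j; exact: ps_refl. Qed.

Lemma pr_trans a b c : pr_le a b -> pr_le b c -> pr_le a c.
Proof.
move=> [ab1 ab2] [bc1 bc2]; split=> [j /ab1/bc1//|j].
exact: ps_trans (ab2 j) (bc2 j).
Qed.

Lemma pr_directed a b : exists c, pr_le a c /\ pr_le b c.
Proof.
pose s j := cid (ps_directed (a.2 j) (b.2 j)).
have Ff : finite_set (sval a.1 `|` sval b.1).
  by rewrite finite_setU; split; [case: a.1|case: b.1].
exists (exist _ _ Ff, fun j => sval (s j)); split; split=> /=.
- by move=> j; left.
- by move=> j; have [] := proj2_sig (s j).
- by move=> j; right.
- by move=> j; have [] := proj2_sig (s j).
Qed.

Lemma pr_hom a b (ab : pr_le a b) : top_hom (pr_map ab).
Proof.
apply: top_hom_into_prod => i.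
pose k : {j | sval b.1 j} := exist _ (sval i) (proj1 ab _ (proj2_sig i)).
exact: (top_hom_comp (f := fun x : pr_obj b => x k) (top_hom_proj k)
  (ps_hom (proj2 ab (sval i)))).
Qed.

Lemma pr_id a (aa : pr_le a a) x : pr_map aa x = x.
Proof.
apply: functional_extensionality_dep => -[j p]; rewrite /pr_map /= ps_id.
by congr (x (exist _ j _)); exact: Prop_irrelevance.
Qed.

Lemma pr_comp a b c (ab : pr_le a b) (bc : pr_le b c) (ac : pr_le a c) x :
  pr_map ab (pr_map bc x) = pr_map ac x.
Proof.
apply: functional_extensionality_dep => -[j p]; rewrite /pr_map /=.
rewrite (ps_comp _ _ (proj2 ac j)).
by congr (ps_map (proj2 ac j) (x (exist _ j _))); exact: Prop_irrelevance.
Qed.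

Definition pr_system : proj_system :=
  ProjSystem pr_inh pr_refl pr_trans pr_directed pr_hom pr_id pr_comp.

Let upd j (k : ps_idx (S j)) (s : forall i, ps_idx (S i)) :
    forall i, ps_idx (S i) :=
  @dfwith {classic J} (fun i => ps_idx (S i)) s j k.

(** The index [upd k s j] equals [k] only propositionally; the order relation allows [ps_map] to
    replace a transport between the two objects. *)
Let le_upd j (k : ps_idx (S j)) s : ps_le k (upd k s j).
Proof. by rewrite /upd (@dfwith_in {classic J}); exact: ps_refl. Qed.

Section Coordinates.
Context (j : J).

(** The value does not depend on the index [a] from which it is computed: two indices have a common
    upper bound, and both values are images of the entry there. *)
Lemma exists_coordinate (k : ps_idx (S j)) :
  exists f : proj_lim pr_system -> ps_obj k, top_hom f /\
    forall (a : pr_idx) (aj : sval a.1 j) (ka : ps_le k (a.2 j)) x,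
      f x = ps_map ka
        ((lim_proj (a : ps_idx pr_system) x : pr_obj a) (exist _ j aj)).
Proof.
have [[_ s]] := pr_inh.
pose b : pr_idx := (exist _ [set j] (finite_set1 j), upd k s).
have kb : ps_le k (b.2 j) by exact: le_upd.
exists (fun x => ps_map kb ((lim_proj (b : ps_idx pr_system) x : pr_obj b)
  (exist _ j erefl))).
split.
  apply: (top_hom_comp _ (ps_hom kb)).
  pose k0 : {i | sval b.1 i} := exist _ j erefl.
  exact: (top_hom_comp (f := @lim_proj pr_system b)
    (g := fun y : pr_obj b => y k0)
    (@top_hom_lim_proj pr_system b) (top_hom_proj k0)).
move=> a aj ka x; have [c [ac bc]] := pr_directed a b.
rewrite -(@lim_projP pr_system _ _ ac) -(@lim_projP pr_system _ _ bc)
  /= /pr_map /=.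
have kc := ps_trans ka (proj2 ac j).
rewrite !(ps_comp _ _ kc).
by congr (ps_map kc
  ((lim_proj (c : ps_idx pr_system) x : pr_obj c) (exist _ j _))); exact: Prop_irrelevance.
Qed.

(** For varying [k] the maps of [exists_coordinate] are compatible, because two of them can be
    evaluated at one common index; together they give the component at [j] of a thread. *)
Lemma exists_coordinates :
  exists2 h : proj_lim pr_system -> proj_lim (S j), top_hom h &
  forall (a : pr_idx) (aj : sval a.1 j) x,
    lim_proj (a.2 j) (h x) = (lim_proj (a : ps_idx pr_system) x : pr_obj a)
      (exist _ j aj).
Proof.
pose f k := cid (exists_coordinate k).
have [|k l kl x|h hh hE] := @lim_lift (S j) _ (fun k => sval (f k)).
- by move=> k; have [] := proj2_sig (f k).
- have [[_ s]] := pr_inh.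
  pose b : pr_idx := (exist _ [set j] (finite_set1 j), upd l s).
  have lb : ps_le l (b.2 j) by exact: le_upd.
  rewrite (proj2 (proj2_sig (f l)) b erefl lb).
  rewrite (proj2 (proj2_sig (f k)) b erefl (ps_trans kl lb)).
  exact: ps_comp.
exists h => // a aj x; rewrite hE.
by rewrite (proj2 (proj2_sig (f _)) a aj (ps_refl _)) ps_id.
Qed.

End Coordinates.

(** [Phi] records the images of a family over every finite set of factors, and [Psi] reassembles the
    family from the components given by [exists_coordinates]. *)
Lemma prod_proj_lim_iso (A : J -> topGroupType) :
  (forall j, top_iso (A j) (proj_lim (S j))) ->
  top_iso (prod_topology A) (proj_lim pr_system).
Proof.
move=> AS.
pose f j := sval (cid (AS j)); pose g j := sval (cid (proj2_sig (cid (AS j)))).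
have fg j : [/\ top_hom (f j), top_hom (g j),
  cancel (f j) (g j) & cancel (g j) (f j)].
  exact: (proj2_sig (cid (proj2_sig (cid (AS j))))).
pose h j := sval (cid2 (exists_coordinates j)).
have hh j : top_hom (h j) by rewrite /h; case: cid2.
have hE j (a : pr_idx) (aj : sval a.1 j) x : lim_proj (a.2 j) (h j x) =
    (lim_proj (a : ps_idx pr_system) x : pr_obj a) (exist _ j aj).
  by rewrite /h; case: cid2.
pose F (a : pr_idx) (x : prod_topology A) : pr_obj a :=
  fun i => lim_proj (a.2 (sval i)) (f (sval i) (x (sval i))).
have [||Phi Phih PhiE] := @lim_lift pr_system (prod_topology A) F.
- move=> a; apply: top_hom_into_prod => i; have [fh _ _ _] := fg (sval i).
  exact: (top_hom_comp (top_hom_comp (top_hom_proj (sval i)) fh)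
    (top_hom_lim_proj _)).
- move=> a b ab x; apply: functional_extensionality_dep => -[j p].
  exact: lim_projP.
pose Psi (t : proj_lim pr_system) : prod_topology A := fun j => g j (h j t).
exists Phi, Psi; split=> //.
- apply: top_hom_into_prod => j; have [_ gh _ _] := fg j.
  exact: (top_hom_comp (hh j) gh).
- move=> x; apply: functional_extensionality_dep => j.
  have [_ _ fK _] := fg j; rewrite /Psi -[RHS]fK; congr (g j _).
  apply: lim_proj_ext => k.
  (* The coordinate at [k] is determined by the one at any index above [k], and the latter is read
     off at an index whose finite set is [[set j]]. *)
  have [[_ s]] := pr_inh.
  pose b : pr_idx := (exist _ [set j] (finite_set1 j), upd k s).
  have kb : ps_le k (b.2 j) by exact: le_upd.
  rewrite -!(lim_projP kb) (hE j b erefl); congr ps_map.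
  by rewrite PhiE.
- move=> t; apply: (@lim_proj_ext pr_system) => a; rewrite PhiE.
  apply: functional_extensionality_dep => -[j p].
  have [_ _ _ gK] := fg j.
  by rewrite /F /= /Psi gK hE.
Qed.

End ProductSystem.

(** * The product as an object of the category and its universal property *)

Section Convergent.
Context (R : realType) (J : Type) (A : J -> topGroupType).
Local Notation P := (prod_topology A).

Lemma prod_abelian_proLie :
  (forall j, is_abelian_proLie_group R (A j)) -> is_abelian_proLie_group R P.
Proof.
move=> hA; split; last first.
  move=> x y; apply: functional_extensionality_dep => j.
  exact: (proj2 (hA j)).
pose S j := sval (cid (proj1 (hA j))).
have SL j : forall i : ps_idx (S j), is_Lie_group R (ps_obj i).
  exact: (proj1 (proj2_sig (cid (proj1 (hA j))))).
exists (pr_system S); split; last first.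
  by apply: prod_proj_lim_iso => j;
    exact: (proj2 (proj2_sig (cid (proj1 (hA j))))).
move=> a; apply: (@is_Lie_group_finite_prod _ _
  (fun j => ps_obj ((a : pr_idx S).2 j))).
  exact: (proj2_sig (a : pr_idx S).1).
by move=> j; exact: SL.
Qed.

Lemma exists_coproduct_hom (H : topGroupType) (psi : forall j, A j -> H) :
  is_abelian_proLie_group R H -> (forall j, top_hom (psi j)) ->
  convergent_family psi ->
  exists2 w : P -> H, top_hom w & forall j a, w (@prod_embed J A j a) = psi j a.
Proof.
move=> [[S [SL [f [g [fh gh fK gK]]]]] Hc] psih psic.
have wi (i : ps_idx S) : exists2 w : P -> ps_obj i, top_hom w &
    forall j a, w (@prod_embed J A j a) = lim_proj i (f (psi j a)).
  have [U U1 Usmall] := Lie_group_no_small_subgroups (SL i).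
  have ph := top_hom_comp fh (top_hom_lim_proj i).
  (* Convergence is applied to the preimage in [H] of a neighbourhood without nontrivial
     subgroups. *)
  have Ff : finite_set [set j | ~ range (psi j) `<=` (lim_proj i \o f) @^-1` U].
    by apply: psic; apply: (proj2 ph 1); rewrite (top_hom1 ph).
  have [w wh wE] := exists_hom_finite Hc psih Ff.
  exists ((lim_proj i \o f) \o w); first exact: top_hom_comp.
  move=> j a; rewrite /= wE; case: pselect => //= jU.
  (* Outside the finite set the image of [A j] is a subgroup contained in [U], so all powers of each
     of its elements lie in [U] and it is trivial. *)
  rewrite [LHS](top_hom1 ph); apply/esym/Usmall => k.
  have jU' : range (psi j) `<=` (lim_proj i \o f) @^-1` U by exact: contrapT.
  suff -> : lim_proj i (f (psi j a)) ^+ k = (lim_proj i \o f) (psi j (a ^+ k)).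
    by apply: jU'; exists (a ^+ k).
  elim: k => [|k IHk];
    first by rewrite !expg0 (top_hom1 (psih j)) (top_hom1 ph).
  by rewrite !expgS IHk (proj1 (psih j)) (proj1 ph).
pose w i := sval (cid2 (wi i)).
have wh i : top_hom (w i) by rewrite /w; case: cid2.
have wE i j a : w i (@prod_embed J A j a) = lim_proj i (f (psi j a)).
  by rewrite /w; case: cid2.
have [//|i k ik|h hh hE] := @lim_lift S _ w.
  (* Both morphisms take the same values on the embedded factors, so density identifies them in the
     Hausdorff group [ps_obj i]. *)
  suff : (ps_map ik \o w k) = w i by move=> <-.
  apply: hom_eq_prod_embed (wh i) _; first by case: (SL i).
    exact: (top_hom_comp (wh k) (ps_hom ik)).
  by move=> j a; rewrite /= !wE lim_projP.
exists (g \o h); first exact: top_hom_comp.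
move=> j a; rewrite /= -[RHS]fK; congr g; apply: lim_proj_ext => i.
by rewrite hE wE.
Qed.

(** Equality is tested in the Lie groups of the system; these are Hausdorff, so the density of the
    elements of finite support applies in each of them. *)
Lemma coproduct_hom_unique (H : topGroupType) (v w : P -> H) :
  is_abelian_proLie_group R H -> top_hom v -> top_hom w ->
  (forall j a, v (@prod_embed J A j a) = w (prod_embed a)) -> v = w.
Proof.
move=> [[S [SL [f [g [fh gh fK gK]]]]] _] vh wh vw.
apply/funext => x; apply: (can_inj fK); apply: lim_proj_ext => i.
have ph := top_hom_comp fh (top_hom_lim_proj i).
suff e : (lim_proj i \o f) \o v = (lim_proj i \o f) \o w.
  exact: (congr1 (fun u : P -> ps_obj i => u x) e).
apply: hom_eq_prod_embed; first by case: (SL i).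
- exact: top_hom_comp.
- exact: top_hom_comp.
- by move=> j a; rewrite /= vw.
Qed.

End Convergent.

Theorem theorem4 (R : realType) (J : Type) (A : J -> topGroupType)
    (hA : forall j, is_abelian_proLie_group R (A j)) :
  is_conditional_coproduct (is_abelian_proLie_group R) (A := A)
    (G := prod_topology A) (fun j => prod_embed (A := A) (i := j)).
Proof.
split.
- exact: prod_abelian_proLie.
- exact: top_hom_prod_embed.
- exact: convergent_prod_embed.
- move=> H psi CH psih psic; have [w wh wE] := exists_coproduct_hom CH psih psic.
  exists w; split=> [|v [vh vE]].
    by split=> // j; apply/funext => a; rewrite /= wE.
  by apply: (coproduct_hom_unique CH) => // j a; rewrite wE vE.
Qed.
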